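(* Let $\mathbb F_q$ be the finite field with $q$ elements. Let $k,s$ be integers with $2\le k<q$ and $s>0$ such that there exist a subgroup $S$ of $\mathrm{AGL}(1,\mathbb F_q)$ and a subset $B\subset\mathbb F_q$ with $|B|=k$, $|S|=s$ and $S=\mathrm{AGL}(1,\mathbb F_q)_B$. Then there is a $(q,k,k(k-1)/s)$ BIBD, and hence $$A_2\Bigl(\frac{q(q-1)}s,\ \frac{2k(q-k)}s,\ \frac{k(q-1)}s\Bigr)=q.$$
   Context: $\mathrm{AGL}(1,\mathbb F_q)=\left\{\left[\begin{smallmatrix}a&b\\0&1\end{smallmatrix}\right]:a\in\mathbb F_q^*,\ b\in\mathbb F_q\right\}$ acts on $\mathbb F_q$ by $\left[\begin{smallmatrix}a&b\\0&1\end{smallmatrix}\right]x=ax+b$. For $B\subset\mathbb F_q$, $\mathrm{AGL}(1,\mathbb F_q)_B=\{\sigma\in \mathrm{AGL}(1,\mathbb F_q):\sigma(B)=B\}$. A $(v,k,\lambda)$ BIBD (balanced incomplete block design), with $v,k,\lambda$ positive integers, is a pair $(V,\mathcal B)$ where $V$ is a $v$-element set and $\mathcal B$ is a finite family of $k$-element subsets (blocks) of $V$ such that each element of $V$ belongs to the same positive number $r$ of blocks and any two distinct elements of $V$ belong to exactly $\lambda$ common blocks. For positive integers $n,d,w$, an $(n,d,w)_2$ code is a subset $C\subset\mathbb F_2^n$ all of whose elements have Hamming weight $w$ and with any two distinct elements at Hamming distance $\ge d$. $A_2(n,d,w)$ is the maximum number of codewords in an $(n,d,w)_2$ code. *)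

(* Defs.v *)
From HB Require Import structures.
From mathcomp Require Import all_boot all_order all_fingroup all_algebra.

Set Implicit Arguments.
Unset Strict Implicit.
Unset Printing Implicit Defensive.

Import GRing.Theory.
Local Open Scope ring_scope.

(* The bottom row is (0, 1); the corner entry a is then nonzero because u is
   invertible (see AGL1P). *)
Definition AGL1 (F : finFieldType) : {set {'GL_2[F]}} :=
  [set u : {'GL_2[F]} |
     ((GLval u : 'M[F]_2) 1 0 == 0) && ((GLval u : 'M[F]_2) 1 1 == 1)].

Definition AGL1_act (F : finFieldType) (u : {'GL_2[F]}) (x : F) : F :=
  (GLval u : 'M[F]_2) 0 0 * x + (GLval u : 'M[F]_2) 0 1.

Definition AGL1_stab (F : finFieldType) (B : {set F}) : {set {'GL_2[F]}} :=
  [set u in AGL1 F | [set AGL1_act u x | x in B] == B].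

Definition AGL1_mx (F : finFieldType) (a b : F) : 'M[F]_2 :=
  \matrix_(i, j) (if i == 0 then (if j == 0 then a else b)
                  else (if j == 0 then 0 else 1)).

Lemma AGL1P (F : finFieldType) (u : {'GL_2[F]}) :
  reflect (exists a b : F, a != 0 /\ GLval u = AGL1_mx a b) (u \in AGL1 F).
Proof.
rewrite inE; apply: (iffP andP) => [[/eqP u10 /eqP u11] | [a [b [_ ->]]]];
  last by rewrite !mxE /= !eqxx.
have defu : GLval u = AGL1_mx ((GLval u : 'M[F]_2) 0 0) ((GLval u : 'M[F]_2) 0 1).
  apply/matrixP => i j; rewrite !mxE.
  case: i => [[|[|//]] lti]; case: j => [[|[|//]] ltj] /=.
  - by congr (GLval u _ _); apply: val_inj.
  - by congr (GLval u _ _); apply: val_inj.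
  - by rewrite -[RHS]u10; congr (GLval u _ _); apply: val_inj.
  - by rewrite -[RHS]u11; congr (GLval u _ _); apply: val_inj.
exists ((GLval u : 'M[F]_2) 0 0), ((GLval u : 'M[F]_2) 0 1); split=> //.
have := GL_det u; apply: contra_neq => u00.
rewrite (expand_det_col _ (0 : 'I_2)) big1 // => i _.
case: i => [[|[|//]] lti].
- by rewrite (_ : Ordinal lti = (0 : 'I_2)) ?u00 ?mul0r //; apply: val_inj.
- by rewrite (_ : Ordinal lti = (1 : 'I_2)) ?u10 ?mul0r //; apply: val_inj.
Qed.

Lemma GL2_mulE (F : finFieldType) (u v : {'GL_2[F]}) (i j : 'I_2) :
  (GLval (u * v)%g : 'M[F]_2) i j =
  (GLval u : 'M[F]_2) i 0 * (GLval v : 'M[F]_2) 0 j +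
  (GLval u : 'M[F]_2) i 1 * (GLval v : 'M[F]_2) 1 j.
Proof.
rewrite GL_ME mxE (big_ord_recl 1) big_ord1.
by rewrite (_ : lift ord0 ord0 = (1 : 'I_2)) //; apply: val_inj.
Qed.

Lemma AGL1_group_set (F : finFieldType) : group_set (AGL1 F).
Proof.
apply/group_setP; split=> [|u v]; first by rewrite inE GL_1E !mxE /= !eqxx.
rewrite !inE => /andP[/eqP u10 /eqP u11] /andP[/eqP v10 /eqP v11].
by rewrite !GL2_mulE u10 u11 v10 v11 !mul0r !add0r mulr0 mulr1 !eqxx.
Qed.

Canonical AGL1_group (F : finFieldType) := Group (AGL1_group_set F).

Lemma AGL1_actM (F : finFieldType) (u v : {'GL_2[F]}) (x : F) :
  v \in AGL1 F -> AGL1_act (u * v)%g x = AGL1_act u (AGL1_act v x).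
Proof.
rewrite inE => /andP[/eqP v10 /eqP v11].
by rewrite /AGL1_act !GL2_mulE v10 v11 mulr0 mulr1 addr0 mulrDr mulrA addrA.
Qed.

(* The blocks form an indexed family, so repeated blocks are allowed and are
   counted with multiplicity. *)
Definition is_BIBD (V I : finType) (block : I -> {set V}) (v k lambda : nat) :
    Prop :=
  [/\ [&& 0 < v, 0 < k & 0 < lambda]%N,
      #|V| = v,
      forall i, #|block i| = k,
      exists2 r : nat, (0 < r)%N & forall x, #|[set i | x \in block i]| = r
    & forall x y, x != y ->
        #|[set i | (x \in block i) && (y \in block i)]| = lambda].

Definition BIBD_exists (v k lambda : nat) : Prop :=
  exists (V I : finType) (block : I -> {set V}), is_BIBD block v k lambda.

Definition hamming_weight (n : nat) (x : 'rV['F_2]_n) : nat :=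
  #|[set i | x 0 i != 0]|.

Definition hamming_dist (n : nat) (x y : 'rV['F_2]_n) : nat :=
  #|[set i | x 0 i != y 0 i]|.

Definition is_code (n d w : nat) (C : {set 'rV['F_2]_n}) : bool :=
  [forall x in C, hamming_weight x == w] &&
  [forall x in C, forall y in C, (x != y) ==> (d <= hamming_dist x y)%N].

Definition A2 (n d w : nat) : nat :=
  \max_(C : {set 'rV['F_2]_n} | is_code d w C) #|C|.

(* Main.v *)
Require Import Defs.
From HB Require Import structures.
From mathcomp Require Import all_boot all_order all_fingroup all_algebra.
From mathcomp Require Import zify ring.

(** Why the theorem holds.  The group AGL(1, F) is sharply 2-transitive on F:
    for fixed x <> y, the map u |-> (u^-1 x, u^-1 y) is a bijection from the
    group onto the ordered pairs of distinct points ([AGL1_pair_count]).  The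
    blocks of the design are the distinct images uB, and by orbit-stabilizer
    each of them is uB for exactly s elements u ([AGL1_orbit_count]).  Hence s
    times a number of blocks is a number of group elements, which the bijection
    turns into a number of pairs (c, e) with c <> e: all of them for the number
    b of blocks, those with c in B for the number r of blocks through x, those
    with c and e in B for the number lambda of blocks through x and y.  So
    s b = q (q - 1), s r = k (q - 1) and s lambda = k (k - 1)
    ([AGL1_orbit_design]).

    The value of A_2 holds for every design with k < v ([A2_BIBD]).  The
    incidence vectors of the v points form a code of constant weight r and
    constant distance 2 (r - lambda).  Conversely, summing the distances over
    all pairs of words of a constant weight code, and applying Cauchy-Schwarz
    to the numbers of words that are nonzero at a given coordinate, gives the
    Johnson bound ([johnson_bound]); by b k = v r and
    r (k - 1) = lambda (v - 1), it says here that a code has at most v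
    words. *)

Import GRing.Theory.

(** * The Johnson bound *)

Lemma card_set_sum (T : finType) (P : pred T) :
  #|[set t | P t]| = \sum_t (P t : nat).
Proof. by rewrite cardsE -sum1_card big_mkcond. Qed.

(** Over a two-element alphabet, two words differ where exactly one of them is
    nonzero. *)
Lemma hamming_distE {n} (x y : 'rV['F_2]_n) :
  hamming_dist x y + 2 * #|[set i | (x 0%R i != 0%R) && (y 0%R i != 0%R)]|
  = hamming_weight x + hamming_weight y.
Proof.
rewrite /hamming_dist /hamming_weight !card_set_sum big_distrr -!big_split /=.
apply: eq_bigr => i _.
by case: (x _ i) => [[|[|//]] ?]; case: (y _ i) => [[|[|//]] ?].
Qed.

Lemma sqr_sum_leq {n} (f : 'I_n -> nat) :
  (\sum_i f i) ^ 2 <= n * \sum_i f i ^ 2.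
Proof.
rewrite -(leq_pmul2l (isT : 0 < 2)).
have -> : 2 * (\sum_i f i) ^ 2 = \sum_i \sum_j 2 * (f i * f j).
  rewrite -mulnn big_distrl big_distrr /=; apply: eq_bigr => i _.
  by rewrite !big_distrr.
have -> : 2 * (n * \sum_i f i ^ 2) = \sum_i \sum_j (f i ^ 2 + f j ^ 2).
  under [RHS]eq_bigr do rewrite big_split sum_nat_const card_ord /=.
  by rewrite big_split /= sum_nat_const card_ord -big_distrr /= mul2n addnn.
by apply: leq_sum => i _; apply: leq_sum => j _; apply: nat_Cauchy.
Qed.

(** Both sides come from two evaluations of the sum of the distances over all
    ordered pairs of words: at least d for each pair of distinct words, and,
    coordinate by coordinate, an expression in the column sums, to which
    Cauchy-Schwarz applies. *)
Lemma johnson_bound {n d w} {C : {set 'rV['F_2]_n}} :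
  is_code d w C ->
  n * d * (#|C| - 1) + 2 * #|C| * w ^ 2 <= 2 * n * w * #|C|.
Proof.
move=> /andP[/forall_inP wtC /forall_inP distC].
set M := #|C|.
pose c i := \sum_(x in C) (x 0%R i != 0%R : nat).
have sumc : \sum_i c i = M * w.
  rewrite exchange_big /= -sum_nat_const; apply: eq_bigr => x xC.
  by rewrite -(eqP (wtC x xC)) /hamming_weight card_set_sum.
have sumc2 : \sum_i c i ^ 2 = \sum_(x in C) \sum_(y in C)
    #|[set i | (x 0%R i != 0%R) && (y 0%R i != 0%R)]|.
  transitivity (\sum_(x in C) \sum_i c i * (x 0%R i != 0%R)).
    rewrite exchange_big; apply: eq_bigr => i _ /=.
    by rewrite -big_distrr /= mulnn.
  apply: eq_bigr => x _; under [RHS]eq_bigr do rewrite card_set_sum.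
  rewrite [RHS]exchange_big; apply: eq_bigr => i _ /=.
  by rewrite /c big_distrl; apply: eq_bigr => y _ /=; do 2!case: (_ != _).
have sumdist : \sum_(x in C) \sum_(y in C) hamming_dist x y
    + 2 * \sum_i c i ^ 2 = 2 * M ^ 2 * w.
  rewrite sumc2 big_distrr -big_split /=.
  rewrite (eq_bigr (fun=> M * (2 * w))) => [|x xC].
    by rewrite sum_nat_const -/M; lia.
  rewrite big_distrr -big_split /= -sum_nat_const; apply: eq_bigr => y yC.
  by rewrite hamming_distE (eqP (wtC x xC)) (eqP (wtC y yC)); lia.
have dist_ge : M * ((M - 1) * d)
    <= \sum_(x in C) \sum_(y in C) hamming_dist x y.
  rewrite -sum_nat_const; apply: leq_sum => x xC.
  rewrite (bigD1 x) //= (leq_trans _ (leq_addl _ _)) //.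
  have -> : M - 1 = #|C :\ x| by rewrite /M (cardsD1 x) xC add1n subn1.
  rewrite -sum_nat_const; under eq_bigl do rewrite !inE andbC.
  apply: leq_sum => y /andP[yC yx].
  by have /forall_inP/(_ y yC)/implyP := distC x xC; apply; rewrite eq_sym.
have := sqr_sum_leq c; rewrite sumc.
case: (posnP M) => [->|M0]; first by rewrite sub0n !muln0 mul0n.
move: sumdist dist_ge; set D := \sum_(x in C) _; set Q := \sum_i _.
move=> eqD leD CS; rewrite -(leq_pmul2l M0).
have : n * (M * ((M - 1) * d)) + 2 * (M * w) ^ 2 <= n * (2 * M ^ 2 * w).
  rewrite -eqD mulnDr (mulnCA n 2).
  by apply: leq_add; rewrite leq_mul2l ?leD ?CS orbT.
by move=> le; apply: etrans le; congr (_ <= _); ring.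
Qed.

(** * Codes from designs *)

Lemma BIBD_replication {V I : finType} {block : I -> {set V}} {v k lambda r} :
  is_BIBD block v k lambda ->
  (forall x, #|[set i | x \in block i]| = r) ->
  #|I| * k = v * r /\ r * (k - 1) = lambda * (v - 1).
Proof.
move=> [/and3P[v0 _ _] cardV cardB _ cardxy] cardx.
have blkE i : \sum_x (x \in block i : nat) = k.
  by rewrite -(cardB i) -sum1_card [RHS]big_mkcond.
have eqbk : #|I| * k = v * r.
  rewrite -cardV -[#|I| * k]sum_nat_const -[#|V| * r]sum_nat_const.
  transitivity (\sum_i \sum_x (x \in block i : nat)).
    by apply: eq_bigr => i _; rewrite blkE.
  rewrite exchange_big; apply: eq_bigr => x _.
  by rewrite -card_set_sum cardx.
split=> //.
have /card_gt0P[x _] : 0 < #|V| by rewrite cardV.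
(* Count the pairs (y, i) with both x and y in block i, including y = x. *)
have: \sum_y #|[set i | (x \in block i) && (y \in block i)]| = r * k.
  under eq_bigr do rewrite card_set_sum.
  rewrite exchange_big /= -(cardx x) card_set_sum big_distrl; apply: eq_bigr => i _ /=.
  rewrite -(blkE i) big_distrr; apply: eq_bigr => y _ /=.
  by do 2!case: (_ \in _).
rewrite (bigD1 x) //= (eq_bigr (fun=> lambda)) => [|y]; last first.
  by rewrite eq_sym; apply: cardxy.
under eq_finset do rewrite andbb.
rewrite cardx sum_nat_const (cardC1 x) cardV.
by rewrite mulnBr muln1 => <-; rewrite addKn subn1 mulnC.
Qed.

(** The maximum is attained by the incidence vectors of the points; the upper
    bound is the Johnson bound, which is tight because all words of this code
    are at the same distance, and because all its column sums are equal to the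
    block size, so that Cauchy-Schwarz is an equality. *)
Lemma A2_BIBD {V I : finType} {block : I -> {set V}} {v k lambda r} :
  is_BIBD block v k lambda -> k < v ->
  (forall x, #|[set i | x \in block i]| = r) ->
  A2 #|I| (2 * (r - lambda)) r = v.
Proof.
move=> design lt_kv cardx; have [eq_bk eq_rk] := BIBD_replication design cardx.
case: design => [/and3P[v0 k0 l0] cardV _ _ cardxy].
have r0 : 0 < r by nia.
have lt_lr : lambda < r by nia.
apply/eqP; rewrite eqn_leq; apply/andP; split.
  apply/bigmax_leqP => C /johnson_bound; move: #|I| #|C| eq_bk => b M eq_bk J.
  case: M J => [//|M]; rewrite subn1 /= => J.
  (* k times the bound, with b k replaced by v r *)
  have {}J : b * k * (r - lambda) * M + M.+1 * k * r ^ 2 <= b * k * r * M.+1.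
    by nia.
  rewrite eq_bk in J.
  have {}J : v * (r - lambda) * M + M.+1 * k * r <= v * r * M.+1.
    by rewrite -(leq_pmul2l r0); nia.
  have e0 : 0 < r - lambda by rewrite subn_gt0.
  have eq_kr : k * r = lambda * v + (r - lambda) by nia.
  rewrite -(leq_pmul2r e0); move: J; rewrite -(mulnA M.+1) eq_kr.
  by rewrite -[X in v * X * M.+1](subnKC (ltnW lt_lr)); nia.
pose word x : 'rV['F_2]_#|I| :=
  (\row_j (x \in block (enum_val j))%:R)%R.
have wordE x j : (word x 0%R j != 0%R) = (x \in block (enum_val j)).
  by rewrite mxE; case: (_ \in _).
have cardE (P : pred I) : #|[set j : 'I_#|I| | P (enum_val j)]| = #|[set i | P i]|.
  rewrite -(card_imset _ (@enum_val_inj I I)); apply: eq_card => i.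
  apply/imsetP/idP => [[j]|]; first by rewrite !inE => Pj ->.
  rewrite !inE => Pi; exists (enum_rank i); last by rewrite enum_rankK.
  by rewrite inE enum_rankK.
have wt x : hamming_weight (word x) = r.
  rewrite /hamming_weight -(cardx x) -cardE.
  by apply: eq_card => j; rewrite !inE wordE.
have dist x y : x != y -> hamming_dist (word x) (word y) = 2 * (r - lambda).
  move=> xy; have := hamming_distE (word x) (word y); rewrite !wt.
  have -> : #|[set j | (word x 0%R j != 0%R) && (word y 0%R j != 0%R)]| = lambda.
    rewrite -(cardxy x y xy) -(cardE (fun i => (x \in block i) && (y \in block i))).
    by apply: eq_card => j; rewrite !inE !wordE.
  by lia.
have word_inj : injective word.
  move=> x y eq_w; apply/eqP; apply: contraTT (leqnn 0) => /dist.
  rewrite eq_w /hamming_dist => d0.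
  have : #|[set i | word y 0%R i != word y 0%R i]| = 0.
    by apply/eqP; rewrite cards_eq0; apply/eqP/setP => i; rewrite !inE eqxx.
  by rewrite d0; lia.
have code : is_code (2 * (r - lambda)) r [set word x | x in V].
  apply/andP; split; apply/forall_inP => _ /imsetP[x _ ->]; first by rewrite wt.
  apply/forall_inP => _ /imsetP[y _ ->]; apply/implyP => xy.
  by rewrite dist //; apply: contraNneq xy => ->.
by rewrite -{1}cardV -(card_imset _ word_inj); apply: leq_bigmax_cond code.
Qed.

(** * Counting in AGL(1, F) *)

Section AffineGroup.

Context {F : finFieldType}.
Implicit Types (u v : {'GL_2[F]}) (x y : F) (B : {set F}).

Lemma AGL1_act1 x : AGL1_act 1%g x = x.
Proof. by rewrite /AGL1_act GL_1E !mxE /= mul1r addr0. Qed.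

Lemma AGL1_actK {u} : u \in AGL1 F -> cancel (AGL1_act u) (AGL1_act u^-1%g).
Proof. by move=> uG x; rewrite -AGL1_actM // mulVg AGL1_act1. Qed.

Lemma AGL1_actKV {u} : u \in AGL1 F -> cancel (AGL1_act u^-1%g) (AGL1_act u).
Proof.
by move=> uG x; rewrite -AGL1_actM ?mulgV ?AGL1_act1 // (@groupV _ (AGL1_group F)).
Qed.

Lemma mem_AGL1_imset u x B : u \in AGL1 F ->
  (x \in [set AGL1_act u c | c in B]) = (AGL1_act u^-1%g x \in B).
Proof.
move=> uG; apply/imsetP/idP => [[c cB ->]|xB]; first by rewrite AGL1_actK.
by exists (AGL1_act u^-1%g x); rewrite ?AGL1_actKV.
Qed.

Lemma AGL1_imsetM u v B : v \in AGL1 F ->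
  [set AGL1_act (u * v)%g c | c in B]
  = [set AGL1_act u c | c in [set AGL1_act v c | c in B]].
Proof.
by move=> vG; rewrite -imset_comp; apply: eq_imset => c /=; rewrite AGL1_actM.
Qed.

Lemma AGL1_mx_unit (a b : F) : a != 0%R ->
  (AGL1_mx a b \in GRing.unit)%R.
Proof.
move=> a0; rewrite -[_ \in _]/(_ \in unitmx) unitmxE -det_tr det_trig.
  by rewrite (big_ord_recl 1) big_ord1 !mxE /= mulr1 unitfE.
apply/is_trig_mxP => i j lt_ij; rewrite !mxE.
by case: i j lt_ij => [[|[|//]] ?] [[|[|//]] ?].
Qed.

Lemma AGL1_trans2 {x y c e} : x != y -> c != e ->
  exists2 u, u \in AGL1 F & AGL1_act u x = c /\ AGL1_act u y = e.
Proof.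
move=> xy ce; have xy0 : (x - y != 0)%R by rewrite subr_eq0.
pose a := ((c - e) / (x - y))%R; pose b := (c - a * x)%R.
have a0 : (a != 0)%R by rewrite mulf_neq0 ?invr_eq0 // subr_eq0.
exists (FinRing.unit 'M[F]_2 (AGL1_mx_unit a b a0) : {'GL_2[F]}).
  by apply/AGL1P; exists a, b.
rewrite /AGL1_act /= !mxE /=; split; rewrite /b; first by rewrite addrC subrK.
by rewrite /a; field.
Qed.

Lemma AGL1_inj2 {x y u v} : x != y -> u \in AGL1 F -> v \in AGL1 F ->
  AGL1_act u x = AGL1_act v x -> AGL1_act u y = AGL1_act v y -> u = v.
Proof.
move=> xy /AGL1P[a [b [_ uE]]] /AGL1P[a' [b' [_ vE]]].
rewrite /AGL1_act uE vE !mxE /= => ex ey.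
have ea : a = a'.
  apply/eqP; rewrite -subr_eq0; have : ((a - a') * (x - y) = 0)%R.
    have -> : ((a - a') * (x - y) =
      (a * x + b) - (a * y + b) - ((a' * x + b') - (a' * y + b')))%R by ring.
    by rewrite ex ey subrr.
  by move/eqP; rewrite mulf_eq0 subr_eq0 subr_eq0 (negPf xy) orbF.
have eb : b = b' by move: ex; rewrite ea; apply: addrI.
by apply: val_inj; rewrite /= uE vE ea eb.
Qed.

(** Sharp 2-transitivity: the ordered pairs of distinct points are a copy of
    the group. *)
Lemma AGL1_pair_count {x y} (P : pred (F * F)) : x != y ->
  #|[set u in AGL1 F | P (AGL1_act u^-1%g x, AGL1_act u^-1%g y)]|
  = #|[set p : F * F | (p.1 != p.2) && P p]|.
Proof.
move=> xy; pose f u := (AGL1_act u^-1%g x, AGL1_act u^-1%g y).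
have GV u : (u^-1%g \in AGL1 F) = (u \in AGL1 F).
  exact: (@groupV _ (AGL1_group F)).
rewrite -(@card_in_imset _ _ f) => [|u v]; last first.
  move=> /setIdP[uG _] /setIdP[vG _] [ex ey].
  by apply: invg_inj; apply: AGL1_inj2 xy _ _ ex ey; rewrite GV.
apply: eq_card => -[c e]; rewrite inE /=; apply/imsetP/andP.
  move=> [u /setIdP[uG Pu] [-> ->]]; split=> //.
  by apply: contraNneq xy => /(can_inj (AGL1_actKV uG)) ->.
move=> [ce Pce]; have [u uG [ux uy]] := AGL1_trans2 xy ce.
by exists u^-1%g; [apply/setIdP; rewrite GV invgK ux uy | rewrite /f invgK ux uy].
Qed.

(** Orbit-stabilizer: the elements u with uB = vB form the left coset of the
    stabilizer of B by v. *)
Lemma AGL1_orbit_count {B} {S : {group {'GL_2[F]}}} (P : pred {set F}) :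
  S = AGL1_stab B :> {set _} ->
  #|[set u in AGL1 F | P [set AGL1_act u c | c in B]]|
  = #|[set A in [set [set AGL1_act u c | c in B] | u in AGL1 F] | P A]| * #|S|.
Proof.
move=> defS; set im := fun u => [set AGL1_act u c | c in B].
rewrite -sum1_card (partition_big im (mem [set A in im @: AGL1 F | P A])) /=.
  rewrite -sum_nat_const; apply: eq_bigr => A.
  rewrite inE => /andP[/imsetP[v vG ->] Pv].
  rewrite sum1dep_card -(card_lcoset S v); apply: eq_card => u.
  rewrite in_set mem_lcoset defS.
  have GM w : (v^-1 * w \in AGL1 F)%g = (w \in AGL1 F).
    by rewrite (@groupMl _ (AGL1_group F)) ?(@groupV _ (AGL1_group F)).
  apply/andP/setIdP => -[].
    move=> /setIdP[uG _] /eqP im_eq; split; first by rewrite GM.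
    rewrite AGL1_imsetM // -/(im u) im_eq -AGL1_imsetM // mulVg.
    by under eq_imset do rewrite AGL1_act1; rewrite imset_id.
  rewrite GM => uG /eqP fixB.
  have im_eq : im u = im v.
    by rewrite -[u](mulKVg v) /im AGL1_imsetM ?GM // fixB.
  by rewrite im_eq eqxx; split=> //; apply/setIdP; rewrite -/(im u) im_eq.
by move=> u /setIdP[uG Pu]; rewrite inE Pu andbT imset_f.
Qed.

(** * The design of the images of B *)

Lemma AGL1_orbit_design {B} {S : {group {'GL_2[F]}}} :
  S = AGL1_stab B :> {set _} -> 1 < #|B| ->
  exists (I : finType) (block : I -> {set F}) (r lambda : nat),
    [/\ is_BIBD block #|F| #|B| lambda,
        forall x, #|[set i | x \in block i]| = r,
        #|I| * #|S| = #|F| * (#|F| - 1),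
        r * #|S| = #|B| * (#|F| - 1)
      & lambda * #|S| = #|B| * (#|B| - 1)].
Proof.
move=> defS B1; set orb := [set [set AGL1_act u c | c in B] | u in AGL1 F].
pose I : finType := {A : {set F} | A \in orb}.
have F1 : 1 < #|F| by apply: leq_trans B1 (max_card _).
have cardI (P : pred {set F}) :
    #|[set i : I | P (val i)]| = #|[set A in orb | P A]|.
  rewrite -(card_imset _ val_inj); apply: eq_card => A; rewrite inE.
  apply/imsetP/andP => [[i]|[Ao PA]]; first by rewrite inE => Pi ->; split; [exact: valP|].
  by exists (exist _ A Ao); rewrite ?inE.
(* A condition P on the block uB that can be read off the preimages of x and y
   under u turns a count of blocks into a count of pairs. *)
have count x y (P : pred {set F}) (Q : pred (F * F)) : x != y ->
    (forall u, u \in AGL1 F -> P [set AGL1_act u c | c in B]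
       = Q (AGL1_act u^-1%g x, AGL1_act u^-1%g y)) ->
    #|[set i : I | P (val i)]| * #|S| = #|[set p : F * F | (p.1 != p.2) && Q p]|.
  move=> xy PQ; rewrite cardI -AGL1_orbit_count // -(AGL1_pair_count _ xy).
  by apply: eq_card => u; rewrite 2!in_set; apply: andb_id2l => uG; rewrite PQ.
have pairs (A D : {set F}) : A \subset D ->
    #|[set p : F * F | (p.1 != p.2) && ((p.1 \in A) && (p.2 \in D))]|
    = #|A| * (#|D| - 1).
  move=> sAD; rewrite -sum1_card.
  under eq_bigl do rewrite inE andbCA.
  rewrite -(pair_big_dep (mem A) (fun c e => (c != e) && (e \in D)) (fun _ _ => 1)) /=.
  rewrite -sum_nat_const; apply: eq_bigr => c cA.
  rewrite sum1dep_card (cardsD1 c D) (subsetP sAD) // add1n subn1 /=.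
  by apply: eq_card => e; rewrite !inE eq_sym.
have neq x : exists y, x != y.
  by exists (x + 1)%R; rewrite -subr_eq0 opprD addNKr oppr_eq0 oner_eq0.
have S0 : 0 < #|S| := cardG_gt0 S.
have cI : #|I| * #|S| = #|F| * (#|F| - 1).
  rewrite -(cardsT F) -(pairs _ _ (subsetT [set: F])).
  have [y xy] := neq 0%R.
  by rewrite -(count 0%R y xpredT) ?cardsE // => u _; rewrite !inE.
have cx x : #|[set i : I | x \in val i]| * #|S| = #|B| * (#|F| - 1).
  have [y xy] := neq x; rewrite -(cardsT F) -(pairs _ _ (subsetT B)).
  rewrite -(count x y (fun A => x \in A)) // => u uG.
  by rewrite mem_AGL1_imset // inE andbT.
have cxy x y : x != y ->
    #|[set i : I | (x \in val i) && (y \in val i)]| * #|S| = #|B| * (#|B| - 1).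
  move=> xy; rewrite -(pairs _ _ (subxx B)).
  rewrite -(count x y (fun A => (x \in A) && (y \in A))) // => u uG.
  by rewrite !mem_AGL1_imset.
have divr : #|S| %| #|B| * (#|F| - 1) by rewrite -(cx 0%R) dvdn_mull.
have divl : #|S| %| #|B| * (#|B| - 1).
  by have [y /cxy<-] := neq 0%R; rewrite dvdn_mull.
exists I, val, (#|B| * (#|F| - 1) %/ #|S|), (#|B| * (#|B| - 1) %/ #|S|).
have cx' x : #|[set i : I | x \in val i]| = #|B| * (#|F| - 1) %/ #|S|.
  by rewrite -(cx x) mulnK.
split; rewrite ?divnK //; split=> //.
- have Bgt0 : 0 < #|B| := ltnW B1.
  rewrite (leq_trans Bgt0 (max_card _)) Bgt0 divn_gt0 //=.
  by rewrite dvdn_leq // muln_gt0 Bgt0 subn_gt0.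
- case=> A /= /imsetP[u uG ->]; apply: card_imset.
  exact: can_inj (AGL1_actK uG).
- exists (#|B| * (#|F| - 1) %/ #|S|); rewrite // divn_gt0 //.
  by rewrite dvdn_leq // muln_gt0 ltnW //= subn_gt0.
- by move=> x y xy; rewrite -(cxy x y xy) mulnK.
Qed.

End AffineGroup.

Theorem mainTheorem3 (F : finFieldType) (q : nat) (hq : #|F| = q) (k s : nat)
    (hk : 2 <= k < q) (hs : 0 < s)
    (hSB : exists (S : {group {'GL_2[F]}}) (B : {set F}),
        [/\ S \subset AGL1 F, #|B| = k, #|S| = s
          & S = AGL1_stab B :> {set {'GL_2[F]}}]) :
  (s %| k * (k - 1) /\ BIBD_exists q k (k * (k - 1) %/ s)) /\
  [/\ s %| q * (q - 1), s %| 2 * k * (q - k), s %| k * (q - 1)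
    & A2 (q * (q - 1) %/ s) (2 * k * (q - k) %/ s) (k * (q - 1) %/ s) = q].
Proof.
case/andP: hk => k1 lt_kq; case: hSB => S [B [_ cB cS defS]].
rewrite -cB in k1.
have [I [block [r [lambda [design cardx eb er el]]]]] := AGL1_orbit_design defS k1.
rewrite hq cB cS in design eb er el.
have ed : 2 * (r - lambda) * s = 2 * k * (q - k).
  by rewrite -mulnA mulnBl er el -mulnBr mulnA; congr (_ * _); lia.
rewrite -eb -er -el -ed !dvdn_mull // !mulnK //.
do !split=> //; first by exists F, I, block.
exact: A2_BIBD design lt_kq cardx.
Qed.
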